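(* Let $a,b\ge 2$ be relatively prime integers, and let $0<a',a''<a$ and $0<b',b''<b$ be the unique integers with $a'b-b'a=1$ and $b''a-a''b=1$. Assume that the zeta maps on $\mathfrak{D}_{a,b}$, $\mathfrak{D}_{a',b'}$ and $\mathfrak{D}_{a'',b''}$ are bijections. Let $Q$ be an $(a,b)$-Dyck path containing the lattice point at level $1$, i.e. the point $(b',a')$, and let $Q'\in\mathfrak{D}_{a',b'}$ and $Q''\in\mathfrak{D}_{a'',b''}$ be the two Dyck paths whose concatenation is $Q$. Then $$\zeta^{-1}(Q)=\zeta^{-1}(Q')\star\zeta^{-1}(Q'').$$
   Context: For relatively prime positive integers $a,b$, an $(a,b)$-Dyck path is a lattice path from $(0,0)$ to $(b,a)$ with unit north steps and unit east steps, all of whose lattice points $(x,y)$ satisfy $ax\le by$; it is drawn in the grid with $a$ rows and $b$ columns. $\mathfrak{D}_{a,b}$ is the set of all of them. The level of a lattice point $(x,y)$ (with respect to $(a,b)$) is $by-ax$. Hooks and cores: the unit box with southeast corner $(x,y)$ has hook filling $by-ax$. The positive hooks of $P\in\mathfrak{D}_{a,b}$ are the positive hook fillings of the boxes of the grid lying below (southeast of) $P$. $\mathfrak{c}(P)$ is the partition whose set of first-column hook lengths is the set of positive hooks of $P$ (it has no hook length equal to $a$ or $b$). For a partition $\kappa$ and a positive integer $m$: consider the hook lengths of the boxes in the first column of $\kappa$; for each residue modulo $m$ that occurs take the largest such hook length; the rows of $\kappa$ with these first-column hook lengths are the $m$-rows. The $m$-boundary of $\kappa$ is the set of boxes with hook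 length less than $m$. Zeta: the partition bounded by a path is the partition whose Young diagram (English notation) is the set of boxes of the grid above (northwest of) the path. $\lambda(P)=(\lambda_1\ge\dots\ge\lambda_a)$ has as parts the numbers of $b$-boundary boxes in the $a$-rows of $\mathfrak{c}(P)$ (padded with zeros). $\zeta(P)$ is the $(a,b)$-Dyck path bounding $\lambda(P)$. The same definitions are used with $(a',b')$ and $(a'',b'')$ in place of $(a,b)$ (these pairs are also relatively prime). An $(a,b)$-Dyck path passing through the point $(b',a')$ (the lattice point of level $1$) is the concatenation of an $(a',b')$-Dyck path (from $(0,0)$ to $(b',a')$) and a translated $(a'',b'')$-Dyck path (from $(b',a')$ to $(b,a)$). Star product: for $P'\in\mathfrak{D}_{a',b'}$ and $P''\in\mathfrak{D}_{a'',b''}$, $P'\star P''$ is the path obtained by cutting $P'$ at its lattice point of highest level and inserting $P''$ there (i.e. the step sequence of $P'$ up to that point, then the steps of $P''$, then the remaining steps of $P'$). The highest-level point of $P'$ is the same whether levels are computed with respect to $(a,b)$ or $(a',b')$. *)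

(* Defs.v *)
From mathcomp Require Import all_boot all_order all_algebra.
From mathcomp Require Import zify.

Set Implicit Arguments.
Unset Strict Implicit.
Unset Printing Implicit Defensive.

(* A lattice path starting at the origin is its sequence of unit steps. *)
Definition north : bool := true.
Definition east : bool := false.
Notation lpath := (seq bool).

Definition xcoord (P : lpath) (k : nat) : nat := count_mem east (take k P).
Definition ycoord (P : lpath) (k : nat) : nat := count_mem north (take k P).

Definition dyck (a b : nat) (P : lpath) : bool :=
  [&& count_mem north P == a, count_mem east P == b
    & all (fun k => a * xcoord P k <= b * ycoord P k) (iota 0 (size P).+1)].

Definition passes_through (P : lpath) (x y : nat) : Prop :=
  exists2 k, k <= size P & xcoord P k = x /\ ycoord P k = y.

Definition level (a b x y : nat) : int := (b%:Z * y%:Z - a%:Z * x%:Z)%R.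

(* The y-th entry is the abscissa of the north step of P from height y to
   height y.+1. *)
Definition north_xs (P : lpath) : seq nat :=
  [seq xcoord P k | k <- iota 0 (size P) & nth east P k == north].

(* A box is given by its southeast corner (x, y); it occupies
   [x - 1, x] * [y, y + 1], so it lies northwest of P iff x is at most the
   abscissa of the north step at height y. *)
Definition box_above (P : lpath) (x y : nat) : bool :=
  x <= nth 0 (north_xs P) y.

Definition grid_boxes (a b : nat) : seq (nat * nat) :=
  [seq (x, y) | x <- iota 1 b, y <- iota 0 a].

(* The hook filling of the box (x, y) is the level of (x, y). *)
Definition positive_hooks (a b : nat) (P : lpath) : seq nat :=
  undup [seq absz (level a b u.1 u.2) | u <- grid_boxes a b
         & ~~ box_above P u.1 u.2 && (0 < level a b u.1 u.2)%R].

(* A partition is the weakly decreasing sequence of its row lengths; box (i, j)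
   is in row i and column j, both counted from 0. *)
Definition hook_length (kappa : seq nat) (i j : nat) : nat :=
  (nth 0 kappa i - j.+1) + count (fun p => j < p) (drop i.+1 kappa) + 1.

Definition first_col_hook (kappa : seq nat) (i : nat) : nat :=
  hook_length kappa i 0.

Definition first_col_hooks (kappa : seq nat) : seq nat :=
  [seq first_col_hook kappa i | i <- iota 0 (size kappa)].

(* If h_0 > ... > h_(k-1) are the first-column hook lengths, then row i has
   h_i - (k - 1 - i) boxes, since h_i counts these and the rows below; see
   first_col_hooksK. *)
Definition partition_of_first_col (H : seq nat) : seq nat :=
  let h := sort geq H in
  [seq nth 0 h i - ((size h).-1 - i) | i <- iota 0 (size h)].

Definition core (a b : nat) (P : lpath) : seq nat :=
  partition_of_first_col (positive_hooks a b P).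

Definition m_rows (m : nat) (kappa : seq nat) : seq nat :=
  [seq i <- iota 0 (size kappa) |
    all (fun j => (first_col_hook kappa j == first_col_hook kappa i %[mod m])
                  ==> (first_col_hook kappa j <= first_col_hook kappa i))
        (iota 0 (size kappa))].

Definition boundary_in_row (m : nat) (kappa : seq nat) (i : nat) : nat :=
  count (fun j => hook_length kappa i j < m) (iota 0 (nth 0 kappa i)).

Definition lambda (a b : nat) (P : lpath) : seq nat :=
  let kappa := core a b P in
  let s := sort geq [seq boundary_in_row b kappa i | i <- m_rows a kappa] in
  s ++ nseq (a - size s) 0.

(* English notation: the first part is the top row of the grid. *)
Definition bounded_partition (P : lpath) : seq nat := rev (north_xs P).

(* path_from b x [:: p_0; p_1; ...] starts at abscissa x, makes its successive
   north steps at abscissas p_0 <= p_1 <= ..., and ends at abscissa b. *)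
Fixpoint path_from (b x : nat) (ps : seq nat) : lpath :=
  if ps is p :: ps' then nseq (p - x) east ++ north :: path_from b p ps'
  else nseq (b - x) east.

Definition bounding_path (b : nat) (la : seq nat) : lpath :=
  path_from b 0 (rev la).

Definition zeta (a b : nat) (P : lpath) : lpath :=
  bounding_path b (lambda a b P).

Definition zeta_bijective (a b : nat) : Prop :=
  [/\ {in dyck a b, forall P, dyck a b (zeta a b P)},
      {in dyck a b &, injective (zeta a b)}
    & {in dyck a b, forall Q, exists2 P, dyck a b P & zeta a b P = Q}].

(* The empty sequence is a junk value, taken only if Q is not the image of an
   (a, b)-Dyck path. *)
Definition zeta_inv (a b : nat) (Q : lpath) : lpath :=
  if [pick t : (a + b).-tuple bool | dyck a b t && (zeta a b t == Q)] is Some t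
  then tval t else [::].

Definition highest_point (a b : nat) (P : lpath) : 'I_(size P).+1 :=
  [arg max_(k > ord0 : 'I_(size P).+1) level a b (xcoord P k) (ycoord P k)]%O.

(* The levels are those with respect to the pair (a, b) of the first path. *)
Definition star (a b : nat) (P R : lpath) : lpath :=
  let k := highest_point a b P in take k P ++ R ++ drop k P.

Lemma north_xs_cat_east n s :
  north_xs (nseq n east ++ s) = [seq n + x | x <- north_xs s].
Proof.
elim: n => [|n IH] /=; first by rewrite map_id.
rewrite -[RHS](@eq_map _ _ (succn \o addn n)) // map_comp -IH {IH}.
set t := _ ++ _; rewrite /north_xs /=.
by rewrite -[1]addn0 iotaDl filter_map -!map_comp.
Qed.

Lemma north_xs_cons_north s : north_xs (north :: s) = 0 :: north_xs s.
Proof.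
rewrite /north_xs /= -[1]addn0 iotaDl filter_map -!map_comp.
by congr (_ :: _); apply: eq_map => k; rewrite /xcoord /= add0n.
Qed.

Lemma bounding_pathK b la :
  sorted geq la -> bounded_partition (bounding_path b la) = la.
Proof.
rewrite -[in sorted _ _](revK la) rev_sorted /bounded_partition /bounding_path.
move=> so; rewrite -[RHS]revK; congr rev; move: (rev la) so => ps.
suff H x : path leq x ps ->
    [seq x + y | y <- north_xs (path_from b x ps)] = ps.
  move=> so; rewrite -[LHS]map_id (@eq_map _ _ _ (addn 0)) // H //.
  by case: (ps) so.
elim: ps x => [|p ps IH] x /=.
  by rewrite -[nseq _ _]cats0 north_xs_cat_east.
case/andP=> xp /IH IHx.
rewrite north_xs_cat_east north_xs_cons_north /= addn0 subnKC //.
congr (_ :: _); rewrite -[RHS]IHx -map_comp.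
by apply: eq_map => y /=; rewrite addnA subnKC.
Qed.

Lemma first_col_hooksK H : uniq H -> all (leq 1) H ->
  first_col_hooks (partition_of_first_col H) = sort geq H.
Proof.
move=> Hu Hp; rewrite /partition_of_first_col; set h := sort geq H.
have hu : uniq h by rewrite sort_uniq.
have hp : all (leq 1) h by rewrite all_sort.
have : sorted geq h by apply: sort_sorted => x y; apply: leq_total.
rewrite -(revK h) rev_sorted => hs.
have {hs hu} : sorted ltn (rev h) by rewrite ltn_sorted_uniq_leq rev_uniq hu.
rewrite -rev_sorted revK => hs.
move: h hs hp => {H Hu Hp} h hs hp.
have lower i : i < size h -> size h - i <= nth 0 h i.
  elim: h hs hp i => //= x h IH xh /andP[x0 hp] [_|i]; last first.
    by rewrite ltnS subSS; apply: IH => //; apply: path_sorted xh.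
  case: h xh hp IH => [|y h] //= /andP[xy yh] hp /(_ yh hp 0 isT) /=; lia.
apply: (@eq_from_nth _ 0); first by rewrite !(size_map, size_iota).
move=> i; rewrite !(size_map, size_iota) => ik.
rewrite /first_col_hooks (nth_map 0) !(size_map, size_iota) // nth_iota // add0n.
rewrite /first_col_hook /hook_length (nth_map 0) ?size_iota // nth_iota // add0n.
rewrite (@eq_in_count _ _ predT); last first.
  move=> p /mem_drop /mapP[j]; rewrite mem_iota add0n => /andP[_ jk] ->.
  by have := lower j jk; rewrite /=; lia.
rewrite count_predT size_drop size_map size_iota.
have := lower i ik; lia.
Qed.

(* Main.v *)
Require Import Defs.
From mathcomp Require Import all_boot all_order all_algebra.
From mathcomp Require Import zify.

Set Implicit Arguments.
Unset Strict Implicit.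
Unset Printing Implicit Defensive.

(** The map zeta is a sweep map: zeta P consists of the steps of P rearranged
    by increasing level of their starting points.  In other words, sorting the
    numbers of east steps that start below the various north steps of P gives
    the abscissas of the north steps of zeta P (lemma rev_lambda).

    To see this, compare core P with P.  In a partition, the hook lengths of
    a row with first-column hook h are the differences h - g, where g runs
    over the numbers below h that are not first-column hooks (row_gaps).  Read
    along the rows of the grid, the positive hooks in the residue class modulo
    a of the starting level l of a north step are l - a, l - 2 a, ..., so the
    a-rows are the rows with first-column hooks l - a > 0 (m_rows_core).  Read along
    the columns, the positive hooks in the residue class modulo b of the final
    level e of an east step are e - b, e - 2 b, ..., so the b - 1 integers below
    a hook h that are relevant for the b-boundary provide one box for each
    east step with e < h (count_gaps).  For h = l - a the condition e < h says
    that the east step starts below level l.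

    Given the sweep description, consider P star R, with R inserted at the
    highest point M of P.  Let L, L1, L2 be the levels for (a, b), (a1, b1),
    (a2, b2).  The two determinant equations give a1 L = a L1 + y and
    a2 L = a L2 - y at height y.  As y is at most a1, respectively a2, and these
    are less than a, the integer L orders points as L1 does on P and as L2
    does on R.  The steps of P after M are moved by (b2, a2), hence lowered by
    just one level, which creates no inversion because distinct steps start
    at distinct levels.  Since M is the highest point of P, and the steps of R
    start at nonnegative levels L, every step of P starts below every step of R
    in P star R.  So the sweep of P star R is the sweep of P followed by the
    sweep of R: zeta (P star R) = zeta P ++ zeta R (zeta_star).  The theorem
    follows by injectivity of zeta. *)

Implicit Types (u v : nat * nat) (P R : lpath).

(** * Starting points of the steps of a path *)

Definition shift (m u : nat * nat) : nat * nat := (m.1 + u.1, m.2 + u.2).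

Definition starts (d : bool) (P : lpath) : seq (nat * nat) :=
  [seq (xcoord P k, ycoord P k) | k <- iota 0 (size P) & nth east P k == d].

Lemma starts_cons d c P :
  starts d (c :: P) =
  (if c == d then [:: (0, 0)] else [::])
    ++ [seq shift (c == east : nat, c == north : nat) u | u <- starts d P].
Proof.
rewrite /starts /= -[1]addn0 iotaDl filter_map -!map_comp.
by case: (c == d) => //=; rewrite -!map_comp.
Qed.

Lemma starts_cat d P R :
  starts d (P ++ R) =
  starts d P
    ++ [seq shift (count_mem east P, count_mem north P) u | u <- starts d R].
Proof.
elim: P => [|c P IH]; first by rewrite -[LHS]map_id; apply: eq_map => -[x y].
rewrite cat_cons !starts_cons IH map_cat catA -map_comp; congr (_ ++ _).
by apply: eq_map => u; rewrite /shift /= !addnA.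
Qed.

Lemma north_xsE P : north_xs P = map fst (starts north P).
Proof. by rewrite -map_comp. Qed.

Lemma starts_north_heights P :
  map snd (starts north P) = iota 0 (count_mem north P).
Proof.
elim: P => //= c P IH; rewrite starts_cons map_cat -map_comp.
rewrite (_ : map (_ \o _) _ = map (addn (c == north)) (map snd (starts north P))).
  by rewrite IH -iotaDl addn0; case: c.
by rewrite -[RHS]map_comp; apply: eq_map.
Qed.

Lemma starts_east_abscissas P :
  map fst (starts east P) = iota 0 (count_mem east P).
Proof.
elim: P => //= c P IH; rewrite starts_cons map_cat -map_comp.
rewrite (_ : map (_ \o _) _ = map (addn (c == east)) (map fst (starts east P))).
  by rewrite IH -iotaDl addn0; case: c.
by rewrite -[RHS]map_comp; apply: eq_map.
Qed.

(** Whichever of the two steps comes first along the path, it is weakly below and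
    left of the other one, and its own unit makes one coordinate strictly
    smaller. *)
Lemma starts_cross P u v : u \in starts north P -> v \in starts east P ->
  (u.1 <= v.1) = (u.2 < v.2).
Proof.
elim: P u v => // c P IH u v; rewrite !starts_cons !mem_cat.
case/orP=> [u0|/mapP[u' Pu ->]]; case/orP=> [v0|/mapP[v' Pv ->]].
- by case: c u0 v0.
- by case: c u0 => //; rewrite inE => /eqP-> /=.
- by case: c v0 => //; rewrite inE => /eqP-> /=; rewrite !ltn0.
- by rewrite /shift /= leq_add2l ltn_add2l; apply: IH.
Qed.

Lemma size_starts d P : size (starts d P) = count_mem d P.
Proof.
case: d.
  by rewrite -(size_map snd) starts_north_heights size_iota.
by rewrite -(size_map fst) starts_east_abscissas size_iota.
Qed.

Lemma starts_uniq d P : uniq (starts d P).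
Proof.
case: d.
  by apply: (@map_uniq _ _ snd); rewrite starts_north_heights iota_uniq.
by apply: (@map_uniq _ _ fst); rewrite starts_east_abscissas iota_uniq.
Qed.

Lemma north_start_lt P u : u \in starts north P -> u.2 < count_mem north P.
Proof.
move=> Pu; have /(map_f snd) := Pu.
by rewrite starts_north_heights mem_iota => /andP[].
Qed.

Lemma east_start_lt P v : v \in starts east P -> v.1 < count_mem east P.
Proof.
move=> Pu; have /(map_f fst) := Pu.
by rewrite starts_east_abscissas mem_iota => /andP[].
Qed.

Lemma north_startP P y : y < count_mem north P ->
  (nth 0 (north_xs P) y, y) \in starts north P.
Proof.
move=> yP; have ys : y < size (starts north P) by rewrite size_starts.
rewrite (_ : (_, _) = nth (0, 0) (starts north P) y) ?mem_nth //.
rewrite north_xsE (nth_map (0, 0)) //.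
have := congr1 (fun s => nth 0 s y) (starts_north_heights P).
rewrite (nth_map (0, 0)) // nth_iota //= add0n.
by case: (nth _ _ _) => x z /= ->.
Qed.

Lemma north_start_nth P u : u \in starts north P -> nth 0 (north_xs P) u.2 = u.1.
Proof.
case/(nthP (0, 0)) => y yP <-; rewrite north_xsE.
have := congr1 (fun s => nth 0 s y) (starts_north_heights P).
rewrite size_starts in yP *.
rewrite (nth_map (0, 0)) ?size_starts // nth_iota //= => ->.
by rewrite (nth_map (0, 0)) ?size_starts.
Qed.

Lemma east_startP P x : x < count_mem east P ->
  exists2 v, v \in starts east P & v.1 = x.
Proof.
move=> xP; have : x \in map fst (starts east P).
  by rewrite starts_east_abscissas mem_iota.
by case/mapP=> v Pv ->; exists v.
Qed.

Lemma coord_le P k : xcoord P k <= count_mem east P /\ ycoord P k <= count_mem north P.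
Proof.
by rewrite /xcoord /ycoord -{2 4}(cat_take_drop k P) !count_cat !leq_addr.
Qed.

Lemma xcoord_cat P R k : xcoord (P ++ R) k = xcoord P k + xcoord R (k - size P).
Proof.
rewrite /xcoord take_cat; case: ltnP => [kP|Pk].
  by rewrite (eqP (ltnW kP : k - size P == 0)) take0 addn0.
by rewrite count_cat (take_oversize Pk).
Qed.

Lemma ycoord_cat P R k : ycoord (P ++ R) k = ycoord P k + ycoord R (k - size P).
Proof.
rewrite /ycoord take_cat; case: ltnP => [kP|Pk].
  by rewrite (eqP (ltnW kP : k - size P == 0)) take0 addn0.
by rewrite count_cat (take_oversize Pk).
Qed.

Lemma dyckP a b P :
  reflect [/\ count_mem north P = a, count_mem east P = b
            & forall k, a * xcoord P k <= b * ycoord P k]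
          (dyck a b P).
Proof.
apply: (iffP and3P) => [[/eqP Pa /eqP Pb /allP Pab]|[-> -> Pab]]; split=> //.
  move=> k; case: (leqP k (size P)) => [kP|Pk].
    by apply: Pab; rewrite mem_iota.
  by rewrite /xcoord /ycoord (take_oversize (ltnW Pk)) Pa Pb mulnC.
by apply/allP=> k _.
Qed.

Lemma dyck_start a b P d u : dyck a b P -> u \in starts d P ->
  [/\ u.1 <= b, u.2 <= a & a * u.1 <= b * u.2].
Proof.
case/dyckP=> Pa Pb Pab /mapP[k _ ->] /=.
by have [xb ya] := coord_le P k; split=> //; rewrite -?Pa -?Pb.
Qed.

Lemma north_start_inj P u v : u \in starts north P -> v \in starts north P ->
  u.2 = v.2 -> u = v.
Proof.
move=> Pu Pv uv; rewrite [u]surjective_pairing [v]surjective_pairing.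
by rewrite -(north_start_nth Pu) -(north_start_nth Pv) uv.
Qed.

Lemma east_start_inj P u v : u \in starts east P -> v \in starts east P ->
  u.1 = v.1 -> u = v.
Proof.
have nthE i : i < count_mem east P -> (nth (0, 0) (starts east P) i).1 = i.
  move=> iP; have := congr1 (fun s => nth 0 s i) (starts_east_abscissas P).
  by rewrite (nth_map (0, 0)) ?size_starts // nth_iota.
case/(nthP (0, 0)) => i iP <- /(nthP (0, 0))[j jP <-].
by rewrite size_starts in iP jP; rewrite !nthE // => ->.
Qed.

Lemma dyck_east_end a b P v : dyck a b P -> v \in starts east P ->
  a * v.1.+1 <= b * v.2.
Proof.
case/dyckP=> _ _ Pab /mapP[k]; rewrite mem_filter mem_iota add0n.
case/andP=> /eqP Pk kP -> /=; have := Pab k.+1.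
by rewrite /xcoord /ycoord (take_nth east kP) Pk -cats1 !count_cat /= !addn0 addn1.
Qed.

(** Two points whose levels agree modulo a lie at the same height, if their
    heights are less than a. *)
Lemma coprime_mod_inj a b y z s t : coprime a b -> y < a -> z < a ->
  b * y + a * s = b * z + a * t -> y = z.
Proof.
move=> ab ya za E; wlog yz : y z s t ya za E / y <= z.
  move=> W; case/orP: (leq_total y z) => [|zy]; first exact: W E.
  by symmetry; apply: W (esym E) zy.
have : a %| b * (z - y).
  by apply/dvdnP; exists (s - t); rewrite mulnBr mulnBl ![_ * a]mulnC; lia.
rewrite Gauss_dvdr // => /dvdn_leq; lia.
Qed.

(** * Hook lengths and first-column hooks *)

Lemma first_col_hooks_cons x s : 0 < x -> all (leq 1) s ->
  first_col_hooks (x :: s) = (x + size s) :: first_col_hooks s.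
Proof.
move=> x0; rewrite all_count => /eqP s0; rewrite /first_col_hooks /=.
rewrite -[1]addn0 iotaDl -map_comp.
congr (_ :: _); rewrite /first_col_hook /hook_length /= drop0 s0; lia.
Qed.

Lemma first_col_hooks_lt x s : sorted geq (x :: s) -> all (leq 1) s ->
  all (fun g => g < x + size s) (first_col_hooks s).
Proof.
elim: s x => // y s IH x /andP[xy ys] /andP[y0 s0].
rewrite first_col_hooks_cons //= {1}addnS ltnS leq_add2r.
rewrite (_ : y <= x) //=.
apply: sub_all (IH y ys s0) => g; rewrite /geq /= in xy *; lia.
Qed.

Lemma first_col_hooks_uniq s : sorted geq s -> all (leq 1) s ->
  uniq (first_col_hooks s).
Proof.
elim: s => // x s IH xs /andP[x0 s0]; rewrite first_col_hooks_cons //=.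
rewrite (IH (path_sorted xs) s0) andbT.
by apply/negP=> /(allP (first_col_hooks_lt xs s0)); rewrite ltnn.
Qed.

(** The rows with at most j boxes are at the bottom; those have first-column
    hooks below this value, while each longer row has a first-column hook
    above it. *)
Lemma first_col_gap s j : sorted geq s -> all (leq 1) s ->
  j + count (fun p => p <= j) s \notin first_col_hooks s.
Proof.
elim: s => // y s IH ys /andP[y0 s0]; rewrite first_col_hooks_cons // inE /=.
have hs := first_col_hooks_lt ys s0.
have [yj|jy] := leqP y j; last first.
  rewrite add0n negb_or IH ?(path_sorted ys) // andbT.
  have := count_size (fun p => p <= j) s; lia.
have /eqP -> : count (fun p => p <= j) s == size s; [rewrite -all_count|].
  have /allP ysy := order_path_min (rev_trans leq_trans) ys.
  by apply/allP=> z /ysy zy; apply: leq_trans zy yj.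
rewrite negb_or; apply/andP; split; first by lia.
by apply/negP=> /(allP hs); lia.
Qed.

(** The difference x + size s - hook length in column j is j plus the number of
    lower rows with at most j boxes.  It increases strictly with j and avoids the
    first-column hooks, so a count of both sides suffices. *)
Lemma gaps_row0 x s : sorted geq (x :: s) -> all (leq 1) (x :: s) ->
  perm_eq [seq x + size s - hook_length (x :: s) 0 j | j <- iota 0 x]
          [seq g <- iota 0 (x + size s) | g \notin first_col_hooks (x :: s)].
Proof.
move=> xs /andP[x0 s0]; set h := x + size s.
have ss := path_sorted xs.
pose gap j := j + count (fun p => p <= j) s.
have gapE : {in iota 0 x, forall j, h - hook_length (x :: s) 0 j = gap j}.
  move=> j; rewrite mem_iota => /andP[_ jx]; rewrite /hook_length /= drop0 /gap.
  have := count_predC (fun p => p <= j) s.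
  rewrite (@eq_count _ (predC _) (fun p => j < p)) => [|p /=]; last by rewrite ltnNge.
  rewrite /h; lia.
move/eq_in_map: gapE => ->.
have gap_lt i j : i < j -> gap i < gap j.
  move=> ij; rewrite /gap -addSn leq_add //.
  by apply: sub_count => p /=; lia.
have gap_inj : injective gap.
  move=> i j gij; case: (ltngtP i j) => // /gap_lt; rewrite gij ltnn //.
rewrite first_col_hooks_cons //.
have gap_uniq : uniq [seq gap j | j <- iota 0 x] by rewrite map_inj_uniq ?iota_uniq.
set F := [seq g <- _ | _].
have sub : {subset [seq gap j | j <- iota 0 x] <= F}.
  move=> g /mapP[j jx ->]; move: jx; rewrite mem_iota mem_filter mem_iota inE negb_or.
  have cs := count_size (fun p => p <= j) s.
  move=> jx; rewrite first_col_gap // /gap /h; lia.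
have Fx : size F <= x.
  have : size (F ++ first_col_hooks s) <= size (iota 0 h).
    apply: uniq_leq_size => [|g].
      rewrite cat_uniq filter_uniq ?iota_uniq // first_col_hooks_uniq // andbT.
      by apply/hasPn=> g gs; rewrite /= mem_filter inE gs orbT.
    rewrite mem_cat mem_filter => /orP[/andP[]//|].
    by move/(allP (first_col_hooks_lt xs s0)); rewrite mem_iota.
  by rewrite size_cat size_map !size_iota leq_add2r.
have [_ mF] : (size [seq gap j | j <- iota 0 x] = size F)
              * ([seq gap j | j <- iota 0 x] =i F).
  by apply: uniq_min_size; rewrite // size_map size_iota.
by apply: uniq_perm; rewrite // filter_uniq ?iota_uniq.
Qed.

(** The rows above row i have larger first-column hooks, so that they do not
    change the set of gaps below the hook of row i. *)
Lemma row_gaps kappa i : sorted geq kappa -> all (leq 1) kappa -> i < size kappa ->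
  perm_eq [seq first_col_hook kappa i - hook_length kappa i j
             | j <- iota 0 (nth 0 kappa i)]
          [seq g <- iota 0 (first_col_hook kappa i)
             | g \notin first_col_hooks kappa].
Proof.
elim: kappa i => // x s IH [|i] xs /andP[x0 s0].
  move=> _; have -> : first_col_hook (x :: s) 0 = x + size s.
    by have [->] := first_col_hooks_cons x0 s0.
  by apply: gaps_row0 => //=; rewrite x0.
rewrite ltnS => is_; have ss := path_sorted xs.
rewrite [X in perm_eq _ X](_ : _ =
  [seq g <- iota 0 (first_col_hook s i) | g \notin first_col_hooks s]).
  exact: IH.
apply: eq_in_filter => g; rewrite mem_iota => /andP[_ gi].
rewrite first_col_hooks_cons // inE negb_or.
suff -> : g != x + size s by [].
have : first_col_hook s i \in first_col_hooks s by rewrite map_f ?mem_iota.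
move/(allP (first_col_hooks_lt xs s0)).
by move/(ltn_trans (gi : g < first_col_hook s i)); rewrite ltn_neqAle => /andP[].
Qed.

(** The part of [partition_of_first_col] that follows the sorting, separated so
    that it is open to induction on the list. *)
Definition unstack (h : seq nat) : seq nat :=
  [seq nth 0 h i - ((size h).-1 - i) | i <- iota 0 (size h)].

Lemma unstack_cons x h : unstack (x :: h) = (x - size h) :: unstack h.
Proof.
rewrite /unstack /= subn0 -[1]addn0 iotaDl -map_comp; congr (_ :: _).
apply/eq_in_map => i; rewrite mem_iota add0n /= => ih.
by rewrite (_ : size h - (1 + i) = (size h).-1 - i) //; lia.
Qed.

Lemma size_lt_decreasing x h : path gtn x h -> all (leq 1) (x :: h) -> size h < x.
Proof.
elim: h x => [|y h IH] x /=; first by rewrite andbT.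
case/andP=> xy yh /and3P[_ y0 h0]; apply: leq_ltn_trans xy.
by apply: IH => //=; rewrite y0.
Qed.

Lemma unstack_partition h : sorted gtn h -> all (leq 1) h ->
  sorted geq (unstack h) && all (leq 1) (unstack h).
Proof.
elim: h => // x h IH xh h0; rewrite unstack_cons.
have hx := size_lt_decreasing xh h0.
case/andP: h0 => _ h0; have {IH} := IH (path_sorted xh) h0.
case: h xh h0 hx => [|y h] xh h0 hx; first by rewrite /=; lia.
rewrite unstack_cons => /andP[sh ph].
apply/andP; split; last by apply/andP; split; [rewrite subn_gt0|].
apply/andP; split; last exact: sh.
by case/andP: xh; rewrite /= /geq /=; lia.
Qed.

(** * The sweep description of zeta *)

(** The starting level of v is less than that of u, with the subtractions moved
    to the other sides. *)
Definition lower a b v u := b * v.2 + a * u.1 < b * u.2 + a * v.1.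

(** When the steps of P are rearranged by increasing starting level, a north step
    lands at the abscissa given by the number of east steps before it. *)
Definition sweep a b P : seq nat :=
  [seq count (fun v => lower a b v u) (starts east P) | u <- starts north P].

Section Hooks.
Variables (a b : nat) (P : lpath).
Hypotheses (a0 : 0 < a) (b0 : 0 < b) (ab : coprime a b) (Pab : dyck a b P).

Let H := positive_hooks a b P.

Lemma positive_hooksP (g : nat) :
  reflect (exists x y, [/\ 0 < x <= b, y < a, nth 0 (north_xs P) y < x,
                           0 < g & g + a * x = b * y])
          (g \in H).
Proof.
rewrite /H /positive_hooks mem_undup; apply: (iffP mapP) => [[[x y]]|].
  rewrite mem_filter /= => /andP[/andP[Pxy lev0] /allpairsP[[x' y'] /= []]].
  rewrite !mem_iota => xb ya [? ?] ->; subst x' y'.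
  exists x, y; rewrite /box_above -ltnNge in Pxy.
  by move: lev0; rewrite /level; split; lia.
case=> x [y [xb ya Pxy g0 gxy]]; exists (x, y); last by rewrite /level /=; lia.
rewrite mem_filter /= /box_above -ltnNge Pxy /=; apply/andP; split.
  by rewrite /level; lia.
by apply/allpairsP; exists (x, y); rewrite !mem_iota /=; split=> //; lia.
Qed.

Lemma positive_hooks_gt0 : all (leq 1) H.
Proof. by apply/allP=> g /positive_hooksP[x [y []]]. Qed.

(** The grid row of the north step starting at u has its positive hooks below the
    level of u, at the distances a, 2 a, ... *)
Lemma hook_row u t g : u \in starts north P -> 0 < t -> 0 < g ->
  g + a * t + a * u.1 = b * u.2 -> g \in H.
Proof.
move=> Pu t0 g0 gu; have [Pa Pb _] := dyckP _ _ _ Pab.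
have := north_start_lt Pu; rewrite Pa => ua.
apply/positive_hooksP; exists (u.1 + t), u.2; split=> //; last by lia.
- have : a * (u.1 + t) < a * b by nia.
  by rewrite ltn_mul2l => /andP[_]; lia.
- by rewrite north_start_nth //; lia.
Qed.

Lemma hook_row_inv (g : nat) : g \in H ->
  exists u t, [/\ u \in starts north P, 0 < t & g + a * t + a * u.1 = b * u.2].
Proof.
case/positive_hooksP=> x [y [xb ya Pxy g0 gxy]]; have [Pa _ _] := dyckP _ _ _ Pab.
rewrite -Pa in ya; have Pu := north_startP ya.
exists (nth 0 (north_xs P) y, y), (x - nth 0 (north_xs P) y).
by split=> //=; nia.
Qed.

(** The grid column of the east step starting at v has its positive hooks below
    the level of the end of this step, at the distances b, 2 b, ... *)
Lemma hook_col v t g : v \in starts east P -> 0 < t -> 0 < g ->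
  g + b * t + a * v.1.+1 = b * v.2 -> g \in H.
Proof.
move=> Pv t0 g0 gv; have [Pa Pb _] := dyckP _ _ _ Pab.
have := east_start_lt Pv; rewrite Pb => vb.
have [_ va _] := dyck_start Pab Pv.
have tv : t <= v.2 by nia.
have ya : v.2 - t < count_mem north P by rewrite Pa; lia.
apply/positive_hooksP; exists v.1.+1, (v.2 - t); split=> //; rewrite -?Pa //.
- rewrite ltnS (starts_cross (north_startP ya) Pv) /=; lia.
- rewrite Pa; nia.
Qed.

Lemma hook_col_inv (g : nat) : g \in H ->
  exists v t, [/\ v \in starts east P, 0 < t & g + b * t + a * v.1.+1 = b * v.2].
Proof.
case/positive_hooksP=> x [y [/andP[x0 xb] ya Pxy g0 gxy]].
have [Pa Pb _] := dyckP _ _ _ Pab.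
have [|v Pv vx] := @east_startP P x.-1; first by lia.
rewrite -Pa in ya; have := starts_cross (north_startP ya) Pv.
rewrite /= vx (_ : _ <= _ = true); last by lia.
move/esym=> yv; exists v, (v.2 - y); split=> //; first by rewrite subn_gt0.
by rewrite vx prednK // addnAC gxy -mulnDr subnKC ?(ltnW yv).
Qed.

Lemma row_inj u v s t : u \in starts north P -> v \in starts north P ->
  b * u.2 + a * s = b * v.2 + a * t -> u = v.
Proof.
move=> Pu Pv E; have [Pa _ _] := dyckP _ _ _ Pab.
apply: (north_start_inj Pu Pv); apply: (coprime_mod_inj _ _ _ E) => //.
  by rewrite -Pa (north_start_lt Pu).
by rewrite -Pa (north_start_lt Pv).
Qed.

Lemma col_inj u v s t : u \in starts east P -> v \in starts east P ->
  a * u.1 + b * s = a * v.1 + b * t -> u = v.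
Proof.
move=> Pu Pv E; have [_ Pb _] := dyckP _ _ _ Pab.
apply: (east_start_inj Pu Pv); apply: (coprime_mod_inj _ _ _ E).
- by rewrite coprime_sym.
- by rewrite -Pb (east_start_lt Pu).
by rewrite -Pb (east_start_lt Pv).
Qed.

(** The level of the end of the east step that starts at v. *)
Let exit_level v := b * v.2 - a * v.1.+1.

Lemma exit_levelE v : v \in starts east P -> exit_level v + a * v.1.+1 = b * v.2.
Proof. by move=> Pv; rewrite /exit_level subnK // (dyck_east_end Pab Pv). Qed.

Lemma exit_level_inj u v s t : u \in starts east P -> v \in starts east P ->
  exit_level u + b * s = exit_level v + b * t -> u = v.
Proof.
move=> Pu Pv E; apply: (@col_inj u v (t + v.2) (s + u.2)) => //.
move: (exit_levelE Pu) (exit_levelE Pv) E; rewrite !mulnDr !mulnS; lia.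
Qed.

(** There are b east steps, and their exit levels are pairwise incongruent
    modulo b. *)
Lemma exit_level_surj g : exists2 v, v \in starts east P & exit_level v = g %[mod b].
Proof.
have [_ Pb _] := dyckP _ _ _ Pab.
pose s := [seq exit_level v %% b | v <- starts east P].
have us : uniq s.
  rewrite map_inj_in_uniq ?starts_uniq // => u v Pu Pv /eqP uv.
  apply: (@exit_level_inj u v (exit_level v %/ b) (exit_level u %/ b)) => //.
  move: (divn_eq (exit_level u) b) (divn_eq (exit_level v) b) (eqP uv); lia.
have [_ sE] : (size s = size (iota 0 b)) * (s =i iota 0 b).
  apply: uniq_min_size => // [r /mapP[v _ ->]|].
    by rewrite mem_iota ltn_pmod.
  by rewrite size_map size_iota size_starts Pb.
have : g %% b \in s by rewrite sE mem_iota ltn_pmod.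
by case/mapP=> v Pv ->; exists v.
Qed.

(** Together with [not_hook_above_exit]: in the residue class of an exit level,
    the natural numbers that are not hooks are those from the exit level on. *)
Lemma above_exit_not_hook v g q : v \in starts east P ->
  g = exit_level v + b * q -> g \notin H.
Proof.
move=> Pv gE; apply/negP=> gH.
have [w [t [Pw t0]]] := hook_col_inv gH.
rewrite -(exit_levelE Pw) => /addIn gw.
have vw : v = w.
  by apply: (@exit_level_inj v w (q + t) 0) => //; rewrite muln0 mulnDr; lia.
by move: gw; rewrite gE vw; nia.
Qed.

(** The only delicate number is 0, which is never a hook: its class modulo b is
    that of the east step arriving at abscissa b, whose exit level is 0 because
    the path stays below height a. *)
Lemma not_hook_above_exit v g t : v \in starts east P ->
  exit_level v = g + b * t -> g \notin H -> t = 0.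
Proof.
move=> Pv evE; case: (posnP t) => // t0; apply: contraNeq => _.
case: (posnP g) => [g0|g0]; last first.
  by apply: (hook_col Pv t0 g0); rewrite -evE exit_levelE.
have := exit_levelE Pv; rewrite evE g0 add0n => E.
have [_ Pb _] := dyckP _ _ _ Pab.
have [_ va _] := dyck_start Pab Pv.
have vb : v.1 < b by rewrite -Pb (east_start_lt Pv).
have : b %| a * v.1.+1.
  by rewrite -(dvdn_addr _ (dvdn_mulr t (dvdnn b))) E dvdn_mulr.
rewrite Gauss_dvdr; last by rewrite coprime_sym.
move/dvdn_leq => /(_ isT) bv; have vE : v.1.+1 = b by lia.
by move: E; rewrite vE; nia.
Qed.

(** The interval from h - b + 1 to h - 1 meets every residue class modulo b once,
    except the class of h.  A class with exit level e contributes a gap iff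
    e < h.  The class of h contributes to neither side, since the hook h is
    below its exit level. *)
Lemma count_gaps (h : nat) : h \in H ->
  count (fun g => (g \notin H) && (h - g < b)) (iota 0 h) =
  count (fun v => exit_level v < h) (starts east P).
Proof.
move=> hH; have h0 : 0 < h := allP (positive_hooks_gt0) h hH.
(* phi v is the largest number below h in the residue class of exit_level v. *)
pose r v := (h.-1 - exit_level v) %% b; pose phi v := h.-1 - r v.
have phiE v : exit_level v < h -> phi v = exit_level v + b * ((h.-1 - exit_level v) %/ b).
  move=> vh; rewrite /phi /r mulnC; have := divn_eq (h.-1 - exit_level v) b.
  by move: (_ %/ _ * _) (_ %% _) => q s; lia.
rewrite -!size_filter -[RHS](size_map phi); apply: perm_size.
apply: uniq_perm.
- by rewrite filter_uniq ?iota_uniq.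
- rewrite map_inj_in_uniq ?filter_uniq ?starts_uniq // => u v.
  rewrite !mem_filter => /andP[uh Pu] /andP[vh Pv].
  by rewrite !phiE // => /exit_level_inj; apply.
move=> g; apply/idP/mapP=> [|[v vs ->]].
  rewrite mem_filter mem_iota => /andP[/andP[gH hg] /andP[_ gh]].
  have [v Pv /eqP vg] := exit_level_surj g; exists v.
    rewrite mem_filter Pv andbT.
    case: (leqP (exit_level v) g) => [vg'|gv]; first exact: leq_ltn_trans vg' gh.
    have E : exit_level v = g + b * ((exit_level v - g) %/ b).
      by rewrite mulnC divnK -?eqn_mod_dvd ?(ltnW gv) // subnKC // ltnW.
    by have := not_hook_above_exit Pv E gH; move: E; nia.
  have vg' : exit_level v <= g.
    rewrite leqNgt; apply/negP=> gv.
    have E : exit_level v = g + b * ((exit_level v - g) %/ b).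
      by rewrite mulnC divnK -?eqn_mod_dvd ?(ltnW gv) // subnKC // ltnW.
    by have := not_hook_above_exit Pv E gH; move: E; nia.
  have E : g = exit_level v + b * ((g - exit_level v) %/ b).
    by rewrite mulnC divnK -?eqn_mod_dvd // 1?eq_sym // subnKC.
  rewrite /phi /r (_ : h.-1 - exit_level v =
    ((g - exit_level v) %/ b) * b + (h.-1 - g)); last by nia.
  rewrite modnMDl modn_small; lia.
move: vs; rewrite !mem_filter mem_iota => /andP[vh Pv].
have rb : r v < b by rewrite ltn_pmod.
rewrite (above_exit_not_hook Pv (phiE v vh)) /=; apply/andP; split; last first.
  by rewrite add0n /phi; lia.
have [//|hr] := ltnP (h - phi v) b.
have := phiE v vh; have : h = phi v + b by rewrite /phi in hr *; lia.
move=> hE pE; have E : h = exit_level v + b * ((h.-1 - exit_level v) %/ b).+1.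
  by rewrite mulnS; lia.
by have := above_exit_not_hook Pv E; rewrite hH.
Qed.

Lemma sort_positive_hooks : sorted gtn (sort geq H) && all (leq 1) (sort geq H).
Proof.
rewrite gtn_sorted_uniq_geq sort_uniq all_sort undup_uniq positive_hooks_gt0 andbT.
by apply: sort_sorted => x y; apply: leq_total.
Qed.

Let kappa := core a b P.

Lemma first_col_core : first_col_hooks kappa = sort geq H.
Proof. by apply: first_col_hooksK; rewrite ?undup_uniq ?positive_hooks_gt0. Qed.

Lemma core_partition : sorted geq kappa && all (leq 1) kappa.
Proof. by case/andP: sort_positive_hooks => *; apply: unstack_partition. Qed.

(** By [row_gaps], the boxes with hook length below b correspond to the gaps
    within distance b of the first-column hook. *)
Lemma boundary_in_row_core i : i < size kappa ->
  boundary_in_row b kappa i =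
  count (fun v => exit_level v < first_col_hook kappa i) (starts east P).
Proof.
move=> ik; have /andP[ks k0] := core_partition; set h := first_col_hook kappa i.
have hH : h \in H by rewrite -(mem_sort geq) -first_col_core map_f ?mem_iota.
rewrite -count_gaps //.
have /permP/(_ (fun g => h - g < b)) := row_gaps ks k0 ik.
rewrite count_map count_filter -/h => E; transitivity (count
  (preim (fun j => h - hook_length kappa i j) (fun g => h - g < b)) (iota 0 (nth 0 kappa i))).
  apply: eq_count => j /=; rewrite subKn // /h /first_col_hook /hook_length.
  by rewrite leq_add2r leq_add ?leq_sub2l // sub_count // => p /=; lia.
rewrite E; apply: eq_count => g /=.
by rewrite andbC first_col_core mem_sort.
Qed.

(** The hooks in the residue class modulo a of the starting level l of a north step
    are l - a, l - 2 a, ..., so l - a is the largest one whenever it is positive. *)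
Lemma m_rows_core :
  perm_eq [seq first_col_hook kappa i | i <- m_rows a kappa]
          [seq b * u.2 - a * u.1 - a | u <- starts north P & a < b * u.2 - a * u.1].
Proof.
have levE u : u \in starts north P -> (b * u.2 - a * u.1) + a * u.1 = b * u.2.
  by move=> Pu; rewrite subnK //; have [] := dyck_start Pab Pu.
have hookE u : u \in starts north P -> a < b * u.2 - a * u.1 ->
    b * u.2 - a * u.1 - a + a + a * u.1 = b * u.2.
  by move=> Pu ua; rewrite -(levE u Pu); lia.
have hinj u v : u \in starts north P -> v \in starts north P ->
    a < b * u.2 - a * u.1 -> a < b * v.2 - a * v.1 ->
    b * u.2 - a * u.1 - a = b * v.2 - a * v.1 - a -> u = v.
  move=> Pu Pv ua va uv; apply: (@row_inj u v v.1 u.1) => //.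
  by move: (levE u Pu) (levE v Pv); lia.
pose top (h : nat) := all (fun g => (g == h %[mod a]) ==> (g <= h)) (sort geq H).
have -> : [seq first_col_hook kappa i | i <- m_rows a kappa] = filter top (sort geq H).
  rewrite -first_col_core filter_map; congr (map _ _); apply: eq_filter => i /=.
  by rewrite /top -first_col_core all_map.
apply: uniq_perm.
- by rewrite filter_uniq // sort_uniq undup_uniq.
- rewrite map_inj_in_uniq ?filter_uniq ?starts_uniq // => u v.
  rewrite !mem_filter => /andP[ua Pu] /andP[va Pv]; by apply: hinj.
move=> h; rewrite mem_filter mem_sort; apply/andP/mapP=> [[/allP htop hH]|[u us ->]].
  have [u [t [Pu t0 uE]]] := hook_row_inv hH.
  have h0 : 0 < h := allP positive_hooks_gt0 h hH.
  have lu : b * u.2 - a * u.1 = h + a * t by rewrite -uE addnK.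
  exists u; first by rewrite mem_filter Pu andbT lu; nia.
  (* Unless t = 1, h + a (t - 1) is a larger hook in the class of h. *)
  rewrite lu; case: t t0 uE lu => [|[|t]] // _ uE lu; first by rewrite muln1 addnK.
  have gH : h + a * t.+1 \in H.
    by apply: (@hook_row u 1) => //; [lia | rewrite -uE mulnS; lia].
  have := htop (h + a * t.+1); rewrite mem_sort => /(_ gH).
  by rewrite addnC mulnC modnMDl eqxx /=; nia.
move: us; rewrite mem_filter => /andP[ua Pu]; split; last first.
  by apply: (@hook_row u 1) => //; [lia | by rewrite muln1 hookE].
apply/allP=> /= g; rewrite mem_sort => gH; apply/implyP=> gh.
have [w [t [Pw t0 wE]]] := hook_row_inv gH.
pose k := b * u.2 - a * u.1 - a; rewrite -/k in gh *.
have kE : k + a + a * u.1 = b * u.2 by apply: hookE.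
have wu : w = u.
  apply: (@row_inj w u (k %/ a + 1 + u.1) (g %/ a + t + w.1)) => //.
  rewrite -wE -kE {2}(divn_eq k a) {1}(divn_eq g a) (eqP gh) !mulnDr !(mulnC _ a).
  by rewrite muln1; lia.
move: wE; rewrite wu -kE => /addIn kt; rewrite -(leq_add2r a) -kt leq_add2l; nia.
Qed.

(** The north steps of level at most a have no a-row.  They account for the
    padding with zeros: exit levels are nonnegative, so every east step starts
    at level at least a. *)
Lemma rev_lambda :
  rev (lambda a b P) = sort leq (sweep a b P).
Proof.
pose l u := b * u.2 - a * u.1.
have levE u : u \in starts north P -> l u + a * u.1 = b * u.2.
  by move=> Pu; rewrite /l subnK //; have [] := dyck_start Pab Pu.
pose F (h : nat) := count (fun v => exit_level v < h) (starts east P).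
pose S := [seq boundary_in_row b kappa i | i <- m_rows a kappa].
have SE : perm_eq S [seq F (l u - a) | u <- starts north P & a < l u].
  have -> : S = map F [seq first_col_hook kappa i | i <- m_rows a kappa].
    rewrite -map_comp; apply/eq_in_map => i; rewrite mem_filter mem_iota.
    by case/andP=> _ /andP[_ ik]; apply: boundary_in_row_core.
  by rewrite (map_comp F (fun u => l u - a)); apply: perm_map m_rows_core.
have FE u : u \in starts north P -> 
    count (fun v => lower a b v u) (starts east P) = F (l u - a).
  move=> Pu; apply: eq_in_count => v Pv.
  rewrite /lower -(levE u Pu) -(exit_levelE Pv) mulnS.
  by move: (exit_level v) (l u) => x y; lia.
have S0 : perm_eq (S ++ nseq (a - size S) 0) (sweep a b P).
  have [Pa _ _] := dyckP _ _ _ Pab.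
  pose N := starts north P.
  have NE : perm_eq N ([seq u <- N | a < l u] ++ [seq u <- N | ~~ (a < l u)]).
    by rewrite perm_sym perm_filterC.
  rewrite perm_sym; apply: perm_trans (perm_map _ NE) _; rewrite map_cat.
  apply: perm_cat.
    rewrite perm_sym (_ : map _ _ = [seq F (l u - a) | u <- N & a < l u]) //.
    by apply/eq_in_map=> u; rewrite mem_filter => /andP[_]; apply: FE.
  have Z : all (pred1 0) [seq count (fun v => lower a b v u) (starts east P)
                           | u <- N & ~~ (a < l u)].
    apply/allP=> n /mapP[u us ->]; move: us.
    rewrite mem_filter -leqNgt => /andP[ua Pu].
    rewrite FE //= (eqP (_ : l u - a == 0)) ?subn_eq0 //.
    by rewrite /F (@eq_count _ _ pred0) ?count_pred0.
  rewrite (all_pred1P _ _ Z) size_map (perm_size SE) size_map -[X in X - _]Pa.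
  by rewrite -size_starts -/N (perm_size NE) size_cat addKn.
apply: (sorted_eq leq_trans anti_leq).
- rewrite rev_sorted /lambda -/kappa -/S (sorted_pairwise (rev_trans leq_trans)).
  rewrite pairwise_cat; apply/and3P; split.
  + by apply/allrelP=> x y _ /nseqP[-> _].
  + rewrite -(sorted_pairwise (rev_trans leq_trans)).
    by apply: sort_sorted => x y; apply: leq_total.
  + by apply/(pairwiseP 0) => i j; rewrite !inE size_nseq !nth_nseq => -> ->.
- by apply: sort_sorted leq_total _.
rewrite perm_rev perm_sym perm_sort perm_sym; apply: perm_trans S0.
by rewrite /lambda -/kappa -/S size_sort perm_cat2r perm_sort.
Qed.
End Hooks.

Lemma path_from_shift b b2 q qs :
  path_from (b + b2) (b + q) [seq b + y | y <- qs] = path_from b2 q qs.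
Proof. by elim: qs q => [|r qs IH] q /=; rewrite subnDl ?IH. Qed.

Lemma path_from_cat b b2 x ps qs : x <= b -> all (fun p => p <= b) ps ->
  path_from (b + b2) x (ps ++ [seq b + y | y <- qs]) =
  path_from b x ps ++ path_from b2 0 qs.
Proof.
elim: ps x => [|p ps IH] x xb /=; last first.
  by case/andP=> pb psb; rewrite IH // -catA.
move=> _; case: qs => [|q qs] /=.
  by rewrite -nseqD; congr nseq; lia.
by rewrite path_from_shift catA -nseqD; congr (nseq _ _ ++ _); lia.
Qed.

Lemma zeta_sweep a b P : 0 < a -> 0 < b -> coprime a b -> dyck a b P ->
  zeta a b P = path_from b 0 (sort leq (sweep a b P)).
Proof. by move=> a0 b0 ab Pab; rewrite /zeta /bounding_path rev_lambda. Qed.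

Lemma sort_cat_shift b s t : all (fun p => p <= b) s ->
  sort leq (s ++ [seq b + y | y <- t]) =
  sort leq s ++ [seq b + y | y <- sort leq t].
Proof.
move=> /allP sb; apply: (sorted_eq leq_trans anti_leq).
- exact: sort_sorted leq_total _.
- rewrite (sorted_pairwise leq_trans) pairwise_cat; apply/and3P; split.
  + apply/allrelP=> x y; rewrite mem_sort => /sb xb /mapP[z _ ->].
    exact: leq_trans xb (leq_addr _ _).
  + by rewrite -(sorted_pairwise leq_trans) sort_sorted //; apply: leq_total.
  + rewrite -(sorted_pairwise leq_trans).
    apply: (@homo_sorted _ _ _ leq) => [x y|]; first by rewrite leq_add2l.
    exact: sort_sorted leq_total _.
rewrite perm_sort; apply: perm_cat; first by rewrite perm_sym perm_sort.
by rewrite perm_map // perm_sym perm_sort.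
Qed.

Lemma sweep_le a b P : dyck a b P -> all (fun p => p <= b) (sweep a b P).
Proof.
case/dyckP=> _ Pb _; apply/allP=> _ /mapP[u _ ->].
by rewrite -Pb -size_starts count_size.
Qed.

(** By coprimality two distinct points of the path at the same level are its two
    ends, and the last point starts no step. *)
Lemma lower_total a b P u v : coprime a b -> 0 < b -> dyck a b P ->
  u \in starts north P -> v \in starts east P ->
  lower a b v u = ~~ lower a b u v.
Proof.
move=> ab b0 Pab Pu Pv; rewrite /lower -leqNgt ltn_neqAle.
case: eqP => //= E; exfalso.
have [Pa Pb _] := dyckP _ _ _ Pab.
have [ub ua _] := dyck_start Pab Pu; have [vb va _] := dyck_start Pab Pv.
have vb' := east_start_lt Pv; have ua' := north_start_lt Pu.
rewrite Pb in vb'; rewrite Pa in ua'.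
have uv := starts_cross Pu Pv.
have [ub'|bu] := ltnP u.1 b.
  have uv1 : u.1 = v.1.
    apply: (@coprime_mod_inj b a _ _ v.2 u.2) => //; first by rewrite coprime_sym.
    by rewrite addnC E addnC.
  have uv2 : b * u.2 = b * v.2 by move: E; rewrite uv1; lia.
  move/eqP: uv2; rewrite eqn_pmul2l // => /eqP uv2.
  by move: uv; rewrite uv1 uv2 ltnn leqnn.
have uE : u.1 = b by lia.
have v0 : v.1 = 0.
  apply: (@coprime_mod_inj b a _ _ u.2 (a + v.2)) => //; first by rewrite coprime_sym.
  by move: E; rewrite uE; lia.
move: E; rewrite uE v0; nia.
Qed.

(** * Zeta and the star product *)

Section Star.
Implicit Types w z : (nat * nat) * (nat * nat).
Variables a b a1 b1 a2 b2 : nat.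
Hypotheses (aE : a = a1 + a2) (bE : b = b1 + b2).
Hypotheses (a10 : 0 < a1) (b10 : 0 < b1) (a20 : 0 < a2) (b20 : 0 < b2).
Hypotheses (det1 : a1 * b = b1 * a + 1) (det2 : b2 * a = a2 * b + 1).

(** At height y, this yields a1 L = a L1 + y for the levels L of (a, b) and L1 of
    (a1, b1); similarly [level_scale2] yields a2 L = a L2 - y. *)
Lemma level_scale1 (y : nat) : a1 * (b * y) = a * (b1 * y) + y.
Proof. by rewrite mulnA det1 mulnDl mul1n -mulnA mulnCA. Qed.

Lemma level_scale2 (y : nat) : a2 * (b * y) + y = a * (b2 * y).
Proof. by rewrite mulnA -{2}[y]mul1n -mulnDl -det2 mulnAC mulnC. Qed.

(** The levels L1 of v and u differ by at least 1, so a L1 differs by at least a,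
    which outweighs the heights in a1 L = a L1 + y. *)
Lemma lower_first u v : u.2 <= a1 -> lower a1 b1 u v -> lower a b u v.
Proof.
rewrite /lower => ua /(leq_mul (leqnn a)).
rewrite -(ltn_pmul2l a10) !mulnDr mulnS !mulnDr !level_scale1.
rewrite ![a1 * (a * _)]mulnCA; lia.
Qed.

Lemma lower_second u v : v.2 <= a2 -> lower a2 b2 u v -> lower a b u v.
Proof.
rewrite /lower => va /(leq_mul (leqnn a)).
rewrite -(ltn_pmul2l a20) !mulnDr mulnS !mulnDr -!level_scale2.
rewrite ![a2 * (a * _)]mulnCA; lia.
Qed.

Variables (P R : lpath).
Hypotheses (Pd : dyck a1 b1 P) (Rd : dyck a2 b2 R).
Hypotheses (ab : coprime a b) (ab1 : coprime a1 b1) (ab2 : coprime a2 b2).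

Let k : nat := highest_point a1 b1 P.
Let M := (xcoord P k, ycoord P k).
Let S := star a1 b1 P R.

Lemma highest_pointP j :
  b1 * ycoord P j + a1 * M.1 <= b1 * M.2 + a1 * xcoord P j.
Proof.
wlog jP : j / j <= size P.
  move=> W; have [|Pj] := leqP j (size P); first exact: W.
  have := W (size P) (leqnn _).
  by rewrite /xcoord /ycoord !(take_oversize (ltnW Pj)) !take_size.
rewrite /M /k /highest_point; case: Order.TotalTheory.arg_maxP => // i _ imax.
by have := imax (Ordinal (jP : j < (size P).+1)) isT; rewrite /level /=; lia.
Qed.

Lemma highest_level_gt0 : a1 * M.1 < b1 * M.2.
Proof.
have [Pa Pb Pab] := dyckP _ _ _ Pd.
have := highest_pointP 1; have := Pab 1; have := Pa.
rewrite /xcoord /ycoord; case: P => [|[] Q] /=; rewrite ?take0 /=; lia.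
Qed.

Lemma star_split j :
  (j <= k /\ xcoord S j = xcoord P j /\ ycoord S j = ycoord P j) \/
  (exists i, xcoord S j = M.1 + xcoord R i /\ ycoord S j = M.2 + ycoord R i) \/
  (exists i, M.2 <= ycoord P i /\ xcoord S j = b2 + xcoord P i
    /\ ycoord S j = a2 + ycoord P i).
Proof.
have [Ra Rb _] := dyckP _ _ _ Rd.
have kP : k <= size P by rewrite -ltnS ltn_ord.
have sk : size (take k P) = k by rewrite size_take_min; apply/minn_idPl.
have coordE (f : lpath -> nat -> nat) :
    (forall T U i, f (T ++ U) i = f T i + f U (i - size T)) ->
    forall i, f S i = f (take k P) i + (f R (i - k) + f (drop k P) (i - k - size R)).
  by move=> fcat i; rewrite /S /star !fcat sk.
have coord0 T i n : i <= n -> xcoord T (i - n) = 0 /\ ycoord T (i - n) = 0.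
  by rewrite -subn_eq0 => /eqP H; rewrite /xcoord /ycoord H take0.
rewrite !(coordE _ xcoord_cat) !(coordE _ ycoord_cat).
have xP i := xcoord_cat (take k P) (drop k P) i.
have yP i := ycoord_cat (take k P) (drop k P) i.
rewrite cat_take_drop sk in xP yP.
have [jk|kj] := leqP j k.
  have jkR : j - k <= size R by lia.
  have [x0 y0] := coord0 R _ _ jk; have [x1 y1] := coord0 (drop k P) _ _ jk.
  have [x2 y2] := coord0 (drop k P) _ _ jkR.
  by left; rewrite xP yP x0 y0 x1 y1 x2 y2 !addn0.
have [xk yk] : xcoord (take k P) j = M.1 /\ ycoord (take k P) j = M.2.
  by rewrite /xcoord /ycoord take_oversize // sk ltnW.
right; rewrite xk yk.
have [jR|Rj] := leqP (j - k) (size R).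
  have [x2 y2] := coord0 (drop k P) _ _ jR.
  by left; exists (j - k); rewrite x2 y2 !addn0.
right; exists (j - size R).
have -> : j - k - size R = j - size R - k by lia.
rewrite xP yP.
have [-> ->] : xcoord (take k P) (j - size R) = M.1
            /\ ycoord (take k P) (j - size R) = M.2.
  by rewrite /xcoord /ycoord take_oversize // sk; lia.
have -> : xcoord R (j - k) = b2 by rewrite /xcoord take_oversize ?(ltnW Rj).
have -> : ycoord R (j - k) = a2 by rewrite /ycoord take_oversize ?(ltnW Rj).
by rewrite leq_addr; split=> //; split; rewrite addnCA.
Qed.

Lemma star_dyck : dyck a b S.
Proof.
have [Pa Pb Pab] := dyckP _ _ _ Pd; have [Ra Rb Rab] := dyckP _ _ _ Rd.
apply/dyckP; split.
- by rewrite !count_cat addnCA -count_cat cat_take_drop Pa Ra aE addnC.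
- by rewrite !count_cat addnCA -count_cat cat_take_drop Pb Rb bE addnC.
have firstP x y : a1 * x <= b1 * y -> a * x <= b * y.
  move=> xy; rewrite -(leq_pmul2l a10) level_scale1 mulnCA.
  exact: leq_trans (leq_mul (leqnn a) xy) (leq_addr _ _).
have first_gt0 x y : 0 < y -> a1 * x <= b1 * y -> a * x < b * y.
  move=> y0 xy; rewrite -(ltn_pmul2l a10) level_scale1 mulnCA.
  by have := leq_mul (leqnn a) xy; lia.
have secondP x y : y <= a2 -> a2 * x <= b2 * y -> a * x <= (b * y).+1.
  move=> ya xy; rewrite -(leq_pmul2l a20) mulnS mulnCA.
  by have := leq_mul (leqnn a) xy; rewrite -level_scale2; lia.
have M0 := highest_level_gt0.
have M2 : 0 < M.2 by case: (M.2) M0 => //; rewrite muln0.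
move=> j; case: (star_split j) => [[_ [-> ->]]|[[i [-> ->]]|[i [Mi [-> ->]]]]].
- by apply: firstP.
- have := first_gt0 _ _ M2 (ltnW M0).
  have [_ Ri] := coord_le R i; rewrite Ra in Ri; have := secondP _ _ Ri (Rab i).
  by rewrite !mulnDr; lia.
have := first_gt0 _ _ (leq_trans M2 Mi) (Pab i).
by rewrite !mulnDr -![a * b2]mulnC det2 mulnC; lia.
Qed.

(** Pairs the starting point of each step of P with the starting point of the
    same step in S. *)
Let tracked d : seq ((nat * nat) * (nat * nat)) :=
  [seq (u, u) | u <- starts d (take k P)]
    ++ [seq (shift M u, shift (b2, a2) (shift M u)) | u <- starts d (drop k P)].

Lemma starts_tracked d : starts d P = map fst (tracked d).
Proof.
rewrite -{1}(cat_take_drop k P) starts_cat map_cat -!map_comp.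
by congr (_ ++ _); rewrite -[LHS]map_id.
Qed.

Lemma starts_star d :
  perm_eq (starts d S) (map snd (tracked d) ++ [seq shift M u | u <- starts d R]).
Proof.
have [Ra Rb _] := dyckP _ _ _ Rd.
rewrite /S /star -/k /tracked !starts_cat Ra Rb -/M.
move: (starts d (take k P)) (starts d R) (starts d (drop k P)) => s1 sR s3.
rewrite !map_cat -!map_comp map_id -catA perm_cat2l perm_catC perm_cat2r.
rewrite (_ : map _ s3 = [seq shift (b2, a2) (shift M u) | u <- s3]) //.
by apply: eq_map => u; rewrite /shift /= !(addnCA b2) !(addnCA a2).
Qed.

Lemma trackedP d w : w \in tracked d ->
  [/\ w.1 \in starts d P, w.2 \in starts d S
    & (w.2 = w.1 /\ w.1.2 <= M.2) \/ (w.2 = shift (b2, a2) w.1 /\ M.2 <= w.1.2)].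
Proof.
move=> Ww; split; first by rewrite starts_tracked map_f.
  by rewrite (perm_mem (starts_star d)) mem_cat map_f.
move: Ww; rewrite mem_cat => /orP[]/mapP[u Pu ->] /=; [left|right]; split=> //.
  by have /mapP[j _ ->] := Pu; have [] := coord_le (take k P) j.
exact: leq_addr.
Qed.

(** A displacement by (b2, a2) lowers the (a, b)-level by 1, so it can turn a strict
    inequality of levels into an equality at worst, which [lower_total] excludes. *)
Lemma lower_tracked w z : w \in tracked north -> z \in tracked east ->
  lower a b z.2 w.2 = lower a1 b1 z.1 w.1.
Proof.
move=> /trackedP[Pw Sw w2] /trackedP[Pz Sz z2].
have b0 : 0 < b by lia.
have keep u v u' v' : u.2 <= a1 -> lower a1 b1 u v ->
    (u' = u \/ u' = shift (b2, a2) u) -> (v' = v \/ v' = shift (b2, a2) v) ->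
    ~~ lower a b v' u'.
  move=> ua /(lower_first ua); rewrite /lower -leqNgt.
  have det2' : b * a2 + 1 = a * b2 by rewrite ![_ * a2]mulnC ![_ * b2]mulnC -det2.
  by move=> uv [->|->] [->|->]; rewrite /shift /= ?mulnDr; lia.
have [_ wa _] := dyck_start Pd Pw; have [_ za _] := dyck_start Pd Pz.
have [w3 z3] : (w.2 = w.1 \/ w.2 = shift (b2, a2) w.1)
            /\ (z.2 = z.1 \/ z.2 = shift (b2, a2) z.1).
  by case: w2 => -[? _]; case: z2 => -[? _]; split; auto.
have [zw|zw] := boolP (lower a1 b1 z.1 w.1).
  rewrite (lower_total ab b0 star_dyck Sw Sz); exact: keep za zw z3 w3.
apply/negbTE; apply: keep wa _ w3 z3.
by rewrite (lower_total ab1 b10 Pd Pw Pz) negbK in zw.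
Qed.

(** M has the highest level in P, and no starting point of R has a negative
    (a, b)-level: from a2 L = a L2 - y this is clear if L2 > 0, and the only
    starting point with L2 = 0 is the origin. *)
Lemma tracked_le_inserted d d' w v : w \in tracked d -> v \in starts d' R ->
  ~~ lower a b (shift M v) w.2.
Proof.
case/trackedP=> Pw _ w2 Rv; rewrite /lower -leqNgt.
have [Ra Rb _] := dyckP _ _ _ Rd.
have [vb va vz] := dyck_start Rd Rv.
have wM : b1 * w.1.2 + a1 * M.1 <= b1 * M.2 + a1 * w.1.1.
  by have /mapP[j _ ->] := Pw; apply: highest_pointP.
have vlev : a * v.1 <= b * v.2.
  have [E|lt] := eqVneq (a2 * v.1) (b2 * v.2); last first.
    have {lt} lt : a2 * v.1 < b2 * v.2 by rewrite ltn_neqAle lt.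
    rewrite -(leq_pmul2l a20) mulnCA.
    by have := leq_mul (leqnn a) lt; rewrite mulnS -level_scale2; lia.
  have v0 : v.1 = 0 \/ v.2 = 0.
    case: d' Rv => Rv; [right|left].
      apply: (@coprime_mod_inj a2 b2 _ _ 0 v.1) => //; last by rewrite E !muln0 addnC.
      by have := north_start_lt Rv; rewrite Ra.
    apply: (@coprime_mod_inj b2 a2 _ _ 0 v.2) => //; last by rewrite E !muln0 addnC.
      by rewrite coprime_sym.
    by have := east_start_lt Rv; rewrite Rb.
  have [-> ->] : v.1 = 0 /\ v.2 = 0 by case: v0 => v0; move: E; rewrite v0; nia.
  by rewrite !muln0.
have {wM} wM := leq_mul (leqnn a) wM.
case: w2 => -[-> wy].
  have : b * w.1.2 + a * M.1 <= b * M.2 + a * w.1.1.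
    rewrite -(leq_pmul2l a10) !mulnDr !level_scale1 ![a1 * (a * _)]mulnCA.
    by move: wM; rewrite !mulnDr; lia.
  by rewrite /shift /= !mulnDr; lia.
have : b * w.1.2 + a * M.1 <= (b * M.2 + a * w.1.1).+1.
  have [_ wa _] := dyck_start Pd Pw.
  rewrite -(leq_pmul2l a10) mulnS !mulnDr !level_scale1 ![a1 * (a * _)]mulnCA.
  by move: wM; rewrite !mulnDr; lia.
have : b * a2 + 1 = a * b2 by rewrite ![_ * a2]mulnC ![_ * b2]mulnC -det2.
by rewrite /shift /= !mulnDr; lia.
Qed.

(** For a north step of P, the east steps of R do not count; for one of R, all b1
    east steps of P count. *)
Lemma sweep_star :
  perm_eq (sweep a b S) (sweep a1 b1 P ++ [seq b1 + y | y <- sweep a2 b2 R]).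
Proof.
have [Pa Pb _] := dyckP _ _ _ Pd; have b0 : 0 < b by lia.
have countE u : count (fun v => lower a b v u) (starts east S) =
    count (fun z => lower a b z.2 u) (tracked east)
    + count (fun v => lower a b (shift M v) u) (starts east R).
  by rewrite (permP (starts_star east)) count_cat !count_map.
apply: perm_trans (perm_map _ (starts_star north)) _.
rewrite map_cat; set s := _ ++ _.
suff -> : s = sweep a1 b1 P ++ [seq b1 + y | y <- sweep a2 b2 R] by [].
rewrite /s; congr (_ ++ _).
  rewrite /sweep !starts_tracked -!map_comp; apply/eq_in_map=> w Ww /=.
  rewrite countE (@eq_in_count _ _ pred0 (starts east R)) => [|v Rv /=]; last first.
    exact/negbTE/(tracked_le_inserted Ww Rv).
  rewrite count_pred0 addn0 count_map; apply: eq_in_count => z Wz /=.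
  exact: lower_tracked.
rewrite /sweep -(map_comp _ (shift M)) -(map_comp (addn b1)).
apply/eq_in_map=> u Ru /=; rewrite countE.
have SM d v : v \in starts d R -> shift M v \in starts d S.
  by move=> Rv; rewrite (perm_mem (starts_star d)) mem_cat map_f ?orbT.
congr (_ + _).
  rewrite (@eq_in_count _ _ predT) => [|z Wz /=].
    by rewrite count_predT -(size_map fst) -starts_tracked size_starts.
  have [_ Sz _] := trackedP Wz.
  rewrite (lower_total ab b0 star_dyck (SM _ _ Ru) Sz).
  exact: tracked_le_inserted Wz Ru.
apply: eq_in_count => v Rv.
have cancelM x y : lower a b (shift M x) (shift M y) = lower a b x y.
  by rewrite /lower /shift /= !mulnDr addnACA [X in _ < X]addnACA ltn_add2l.
have [_ ua _] := dyck_start Rd Ru; have [_ va _] := dyck_start Rd Rv.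
have [vu|vu] := boolP (lower a2 b2 v u).
  by rewrite cancelM lower_second.
rewrite (lower_total ab b0 star_dyck (SM _ _ Ru) (SM _ _ Rv)) cancelM.
rewrite lower_second //.
by rewrite (lower_total ab2 b20 Rd Ru Rv) negbK in vu.
Qed.

Lemma zeta_star : zeta a b S = zeta a1 b1 P ++ zeta a2 b2 R.
Proof.
rewrite !zeta_sweep ?star_dyck //; [|lia|lia].
have /perm_sortP -> // := sweep_star;
  [|exact: leq_total|exact: leq_trans|exact: anti_leq].
rewrite sort_cat_shift ?sweep_le // bE path_from_cat // all_sort.
exact: sweep_le Pd.
Qed.

End Star.

(** * The inverse of zeta *)

Lemma zeta_invK a b P : zeta_bijective a b -> dyck a b P ->
  zeta_inv a b (zeta a b P) = P.
Proof.
case=> _ zinj _ Pd; rewrite /zeta_inv; case: pickP => [t /andP[td /eqP tz]|].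
  exact: zinj.
have [Pa Pb _] := dyckP _ _ _ Pd.
have sP : size P == a + b.
  by rewrite -Pa -Pb -(count_predC (pred1 north) P) eqn_add2l; apply/eqP/eq_count; case.
by move/(_ (Tuple sP)); rewrite /= Pd eqxx.
Qed.

Theorem theorem8p1 (a b a' b' a'' b'' : nat)
    (ha : 2 <= a) (hb : 2 <= b) (hab : coprime a b)
    (ha' : 0 < a' < a) (ha'' : 0 < a'' < a)
    (hb' : 0 < b' < b) (hb'' : 0 < b'' < b)
    (h' : (a'%:Z * b%:Z - b'%:Z * a%:Z = 1)%R)
    (h'' : (b''%:Z * a%:Z - a''%:Z * b%:Z = 1)%R)
    (hzeta : zeta_bijective a b)
    (hzeta' : zeta_bijective a' b')
    (hzeta'' : zeta_bijective a'' b'')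
    (Q Q' Q'' : seq bool)
    (hQ : dyck a b Q) (hQthrough : passes_through Q b' a')
    (hQ' : dyck a' b' Q') (hQ'' : dyck a'' b'' Q'')
    (hcat : Q = Q' ++ Q'') :
  zeta_inv a b Q = star a' b' (zeta_inv a' b' Q') (zeta_inv a'' b'' Q'').
Proof.
have det1 : a' * b = b' * a + 1 by lia.
have det2 : b'' * a = a'' * b + 1 by lia.
case/dyckP: hQ => Qa Qb _; case/dyckP: (hQ') => Qa' Qb' _.
case/dyckP: (hQ'') => Qa'' Qb'' _.
have aE : a = a' + a'' by rewrite -Qa hcat count_cat Qa' Qa''.
have bE : b = b' + b'' by rewrite -Qb hcat count_cat Qb' Qb''.
have [_ _ /(_ _ hQ')[P Pd PQ]] := hzeta'.
have [_ _ /(_ _ hQ'')[R Rd RQ]] := hzeta''.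
have cop x y s t : x * s = y * t + 1 -> coprime x y.
  move=> E; rewrite /coprime -dvdn1 -(dvdn_addr _ (_ : gcdn x y %| y * t)).
    by rewrite -E dvdn_mulr ?dvdn_gcdl.
  by rewrite dvdn_mulr ?dvdn_gcdr.
have ab1 : coprime a' b' by apply: (cop _ _ b a).
have ab2 : coprime a'' b'' by rewrite coprime_sym; apply: (cop _ _ a b).
have [a'0 _] := andP ha'; have [a''0 _] := andP ha''.
have [b'0 _] := andP hb'; have [b''0 _] := andP hb''.
rewrite hcat -PQ -RQ.
rewrite -(zeta_star aE bE a'0 b'0 a''0 b''0 det1 det2 Pd Rd hab ab1 ab2).
rewrite !zeta_invK //.
exact: (star_dyck aE bE a'0 b'0 a''0 b''0 det1 det2 Pd Rd hab ab1 ab2).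
Qed.
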